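(* Let $T$ be a finite tree and for each edge $e\in E(T)$ let an edge density $\gamma_e=1-r_e\in[0,1]$ be given. Let $$F(\underline{r_e},t)=\sum_{M\in\mathcal M}\Big(\prod_{e\in M}r_e\Big)(-t)^{|M|},$$ where $\mathcal M$ is the set of all matchings of $T$, including the empty matching. Then the edge densities $(\gamma_e)_{e\in E(T)}$ ensure the existence of the tree $T$ as a transversal if and only if $F(\underline{r_e},t)>0$ for all $t\in[0,1]$.
   Context: All graphs are finite and simple. A weighted blow-up graph $G[H]$ of a graph $H$ is a graph whose vertex set is the disjoint union of finite nonempty clusters $A_v$ ($v\in V(H)$), whose edges only join vertices of $A_u$ to vertices of $A_v$ with $uv\in E(H)$ (not necessarily all such pairs), together with non-negative vertex weights $w$ such that the total weight of each cluster is $1$. For $uv\in E(H)$ the density is $d(A_u,A_v)=\sum w(x)w(y)$, the sum running over all edges $xy$ of $G[H]$ with $x\in A_u$, $y\in A_v$. $G[H]$ contains $H$ as a transversal if one can choose a vertex $\varphi(v)\in A_v$ for every $v\in V(H)$ such that $\varphi(u)\varphi(v)\in E(G[H])$ for every $uv\in E(H)$. Numbers $(\gamma_e)_{e\in E(H)}$ ensure the existence of $H$ as a transversal if every weighted blow-up graph of $H$ with $d(A_u,A_v)\ge\gamma_{uv}$ for all $uv\in E(H)$ contains $H$ as a transversal. A matching is a set of pairwise disjoint edges. *)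

(* Defs.v *)
From mathcomp Require Import all_boot all_order all_algebra.
From mathcomp Require Import reals.

Set Implicit Arguments.
Unset Strict Implicit.
Unset Printing Implicit Defensive.

Import Order.TTheory GRing.Theory Num.Theory.
Local Open Scope ring_scope.

Record sgraph := SGraph {
  vertex :> finType;
  adj : rel vertex;
  adj_sym : symmetric adj;
  adj_irrefl : irreflexive adj }.

Definition edges (G : sgraph) : {set {set G}} :=
  [set e | [exists x, exists y, adj x y && (e == [set x; y])]].

Definition connected (G : sgraph) : Prop :=
  forall x y : G, connect (@adj G) x y.

(* The bound on the size is needed: for an edge xy, [:: x; y] is an adj-cycle
   in the sense of path.v. *)
Definition acyclic (G : sgraph) : Prop :=
  forall c : seq G, (2 < size c)%N -> ~ ucycle (@adj G) c.

Definition is_tree (G : sgraph) : Prop :=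
  [/\ (0 < #|G|)%N, connected G & acyclic G].

Definition matchings (G : sgraph) : {set {set {set G}}} :=
  [set M : {set {set G}} | (M \subset edges G) && trivIset M].

(* The partition of the vertices into the clusters A_v is encoded by the map
   [proj] sending each vertex of A_v to v. *)
Record blowup (R : realType) (H : sgraph) := Blowup {
  bgraph :> sgraph;
  proj : bgraph -> H;
  weight : bgraph -> R;
  proj_surj : forall v, exists x, proj x = v;
  proj_adj : forall x y, adj x y -> adj (proj x) (proj y);
  weight_ge0 : forall x, 0 <= weight x;
  weight_sum1 : forall v, \sum_(x | proj x == v) weight x = 1 }.

Definition cluster (R : realType) (H : sgraph) (G : blowup R H) (v : H) :
    {set G} := [set x | proj x == v].

Definition density (R : realType) (H : sgraph) (G : blowup R H) (u v : H) : R :=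
  \sum_(x in cluster G u) \sum_(y in cluster G v | adj x y)
    weight x * weight y.

Definition has_transversal (R : realType) (H : sgraph) (G : blowup R H) : Prop :=
  exists phi : H -> G,
    (forall v, phi v \in cluster G v) /\
    (forall u v, adj u v -> adj (phi u) (phi v)).

(* Edge-indexed families are functions on all of {set H}; only their values on
   [edges H] matter, here and in [matching_F]. *)
Definition ensures_transversal (R : realType) (H : sgraph)
    (gamma : {set H} -> R) : Prop :=
  forall G : blowup R H,
    (forall u v, adj u v -> gamma [set u; v] <= density G u v) ->
    has_transversal G.

Definition matching_F (R : realType) (G : sgraph) (r : {set G} -> R) (t : R) : R :=
  \sum_(M in matchings G) (\prod_(e in M) r e) * (- t) ^+ #|M|.

(* Main.v *)
Require Import Defs.
From mathcomp Require Import all_boot all_order all_algebra.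
From mathcomp Require Import reals ring.

Set Implicit Arguments.
Unset Strict Implicit.
Unset Printing Implicit Defensive.

Import Order.TTheory GRing.Theory Num.Theory.
Local Open Scope ring_scope.

(** Root the tree, write [r_u] for the value of [r] at the edge from [u] to its
    parent, and define the survival weights from the leaves up by
    [s_t(v) = 1 - t * \sum_u r_u / s_t(u)], the sum running over the children
    [u] of [v]. Both sides of the equivalence say that all weights [s_1(v)] are
    positive.

    Transversals. In a blow-up with the prescribed densities, call a vertex of
    the cluster of [v] extendable if it starts a transversal of the part of the
    tree below [v]. A vertex is lost through the child [u] when it has no
    extendable neighbour in the cluster of [u]; the lost vertices and the
    extendable ones of [u] span no edge, so the product of their masses is at
    most [r_u]. By induction the extendable vertices at [v] have mass at least
    [s_1(v)] ([extendable_mass]), and if [s_1] is positive at the root a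
    transversal is found from the root down.

    If some [s_1(v)] is not positive, take as cluster of [v] the set of edges of
    the tree at [v], and forbid only the pairs that choose the same edge at both
    of its ends. A transversal would be an injection of the vertices of the tree
    into its edges, of which there is one fewer ([choice_blowup_no_transversal]).
    The density condition asks for weights, of sum [1] at each vertex, such that
    the two weights of each edge have product at most [r]; the equation for
    [s_1] produces them from the leaves up, and when some [s_1(v)] is not
    positive there is weight to spare, so the root, which has no parent edge, can
    be satisfied too ([extremal_weight]).

    The polynomial. Eliminating the vertices from the leaves up shows that
    [F(t)] is the product of the [s_t(v)] as long as these are positive
    ([matching_F_survive]). The weights decrease in [t], so positivity at [t = 1]
    gives [F > 0] on the whole of [[0, 1]]. Conversely, the weights are positive
    at [t = 0] and at most [1], hence at least [F(t)] as long as they are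
    positive; if [F > 0] on [[0, 1]], they stay positive up to [t = 1]
    ([survive_of_matching_F]). *)

(** * Rooted trees *)

(** The edges of a rooted tree are indexed by their lower ends, the vertices
    other than the root; [depth] need only decrease along [par], as it serves as
    a rank for recursion. *)
Record rooting (T : sgraph) := Rooting {
  troot : T;
  par : T -> T;
  depth : T -> nat;
  depth_par : forall v, v != troot -> (depth (par v) < depth v)%N;
  adj_par : forall u v, adj u v =
    (u != troot) && (par u == v) || (v != troot) && (par v == u) }.

Definition inside (G : sgraph) (S : {set G}) : rel G :=
  [rel x y | [&& adj x y, x \in S & y \in S]].

(** A rooting of the subgraph induced on [S], which is moreover connected. *)
Definition partial_rooting (G : sgraph) (S : {set G}) (rt : G) (pr : G -> G)
    (dp : G -> nat) : Prop :=
  [/\ rt \in S,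
      {in S, forall v, v != rt -> (pr v \in S) && (dp (pr v) < dp v)%N},
      {in S &, forall u v, adj u v =
         (u != rt) && (pr u == v) || (v != rt) && (pr v == u)}
    & {in S, forall v, connect (inside S) rt v}].

Lemma inside_sym (G : sgraph) (S : {set G}) : symmetric (inside S).
Proof. by move=> x y; rewrite /inside /= adj_sym [(x \in S) && _]andbC. Qed.

(** Two neighbours of [x] in [S] would close, together with a path of [S] that
    joins them, a cycle through [x]. *)
Lemma acyclic_unique_neighbor (G : sgraph) (S : {set G}) (x y z : G) :
  acyclic G -> x \notin S -> connect (inside S) y z ->
  y \in S -> adj x y -> adj x z -> z = y.
Proof.
move=> acG xS /connectP[q pq zq] yS xy; rewrite {z}zq => xz.
case/shortenP: pq xz => p pp up _ xz.
case: p pp up xz => [//|a p] pp up xz; exfalso.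
apply: (acG (x :: y :: a :: p)) => //; rewrite /ucycle; apply/andP; split.
  rewrite /= rcons_path xy [adj (last _ _) _]adj_sym xz andbT /=.
  by apply: (@sub_path _ (inside S) _ _ y (a :: p)) => // u v /and3P[].
rewrite cons_uniq up andbT; apply: contra xS => xp.
have pathS s w : w \in S -> path (inside S) w s -> all (mem S) (w :: s).
  elim: s w => [|b s IHs] w wS; first by rewrite /= wS.
  by rewrite /= wS /= => /andP[/and3P[_ _ bS] /(IHs b bS)].
by have /allP/(_ x xp) := pathS _ y yS pp.
Qed.

(** The new vertex [x] becomes a leaf below [y], its only neighbour in [S]. *)
Lemma partial_rooting_extend (G : sgraph) (S : {set G}) rt pr dp (x y : G) :
  acyclic G -> partial_rooting S rt pr dp ->
  x \notin S -> y \in S -> adj x y ->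
  partial_rooting (x |: S) rt (fun v => if v == x then y else pr v)
    (fun v => if v == x then (dp y).+1 else dp v).
Proof.
move=> acG [rtS prS adjS conS] xS yS xy.
have nx v : v \in S -> v == x = false.
  by move=> vS; apply: contraNF xS => /eqP <-.
have sub : subrel (inside S) (connect (inside (x |: S))).
  move=> u v /and3P[uv uS vS]; apply: connect1.
  by rewrite /inside /= uv !in_setU1 uS vS !orbT.
have con v : v \in S -> connect (inside (x |: S)) rt v.
  by move=> vS; apply: (connect_sub sub); apply: conS.
have xadj v : v \in S -> adj x v = (y == v).
  move=> vS; apply/idP/eqP => [xv|<- //].
  apply/esym/(acyclic_unique_neighbor acG xS _ yS xy xv).
  apply: (connect_trans (y := rt)); last exact: conS.
  by rewrite (sym_connect_sym (@inside_sym _ S)) conS.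
have xrt : x != rt by apply: contraNneq xS => ->.
split.
- by rewrite in_setU1 rtS orbT.
- move=> v; rewrite in_setU1; case: eqP => [-> _ _|_ /= vS vr].
    by rewrite in_setU1 yS orbT /= (nx y yS) leqnn.
  by have /andP[pS dlt] := prS v vS vr; rewrite in_setU1 pS orbT /= (nx _ pS).
- have half v : v \in S -> adj x v = (x != rt) && (y == v) || (v != rt) && (pr v == x).
    move=> vS; rewrite (xadj _ vS) xrt /=; case vr: (v == rt); first by rewrite orbF.
    by have /andP[pS _] := prS v vS (negbT vr); rewrite (nx _ pS) orbF.
  move=> u v; rewrite !in_setU1.
  case: (eqVneq u x) => [-> _|ux /= uS]; case: (eqVneq v x) => [->|vx] /=.
  + by move=> _; rewrite adj_irrefl eq_sym (nx y yS) andbF.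
  + exact: half.
  + by move=> _; rewrite adj_sym half // orbC.
  + exact: adjS.
- move=> v; rewrite in_setU1 => /orP[/eqP->|]; last exact: con.
  apply: (connect_trans (con y yS)); apply: connect1.
  by rewrite /inside /= adj_sym xy !in_setU1 yS eqxx orbT.
Qed.

Lemma connected_boundary (G : sgraph) (S : {set G}) (y : G) :
  connected G -> y \in S -> S != setT ->
  exists x z, [/\ x \notin S, z \in S & adj x z].
Proof.
move=> cG yS SnT.
have [x xS] : exists x, x \notin S.
  by apply/existsP; rewrite -negb_forall; apply: contra SnT => /forallP SA;
     apply/eqP/setP => x; rewrite inE SA.
have /connectP[p pp xl] := cG y x.
elim: p y yS pp xl => [|a p IHp] y yS /=; first by move=> _ xy; rewrite xy yS in xS.
case/andP=> ya pp xl; case aS: (a \in S); first exact: (IHp a).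
by exists a, y; split; rewrite ?aS // adj_sym.
Qed.

(** The rooted part grows by one vertex at a time, by connectedness, until it is
    the whole tree. *)
Lemma tree_rooting (T : sgraph) : is_tree T -> inhabited (rooting T).
Proof.
case=> /card_gt0P[rt _] cT acT.
have grow n : (n < #|T|)%N ->
    exists S pr dp, @partial_rooting T S rt pr dp /\ #|S| = n.+1.
  elim: n => [_|n IHn nT].
    exists [set rt], id, (fun=> 0%N); rewrite cards1; split=> //; split.
    - exact: set11.
    - by move=> v /set1P-> /eqP.
    - by move=> u v /set1P-> /set1P->; rewrite adj_irrefl eqxx.
    - by move=> v /set1P->; apply: connect0.
  have [S [pr [dp [pS cS]]]] := IHn (ltnW nT).
  have SnT : S != setT.
    by apply: contraTneq nT => ST; rewrite -leqNgt -cS ST cardsT.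
  have rtS : rt \in S by case: pS.
  have [x [y [xS yS xy]]] := connected_boundary cT rtS SnT.
  exists (x |: S); do 2 eexists; split; first exact: partial_rooting_extend pS xS yS xy.
  by rewrite cardsU1 xS cS.
have cT0 : (0 < #|T|)%N by apply/card_gt0P; exists rt.
have [|S [pr [dp [[_ prS adjS _] cS]]]] := grow #|T|.-1; first by rewrite prednK.
have ST v : v \in S.
  have SE : S = [set: T].
    by apply/eqP; rewrite eqEcard subsetT cardsT cS prednK //=.
  by rewrite SE inE.
constructor; apply: (@Rooting T rt pr dp).
  by move=> v vr; have /andP[] := prS v (ST v) vr.
by move=> u v; apply: adjS.
Qed.

Definition child (T : sgraph) (Q : rooting T) (v u : T) : bool :=
  (u != troot Q) && (par Q u == v).

Definition height (T : sgraph) (Q : rooting T) (v : T) : nat :=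
  (\max_w depth Q w - depth Q v)%N.

Lemma child_depth (T : sgraph) (Q : rooting T) v u :
  child Q v u -> (depth Q v < depth Q u)%N.
Proof. by case/andP=> ur /eqP <-; apply: depth_par. Qed.

Lemma child_height (T : sgraph) (Q : rooting T) v u :
  child Q v u -> (height Q u < height Q v)%N.
Proof.
move=> /child_depth duv; apply: ltn_sub2l => //.
exact: leq_trans duv (leq_bigmax u).
Qed.

Lemma child_adj (T : sgraph) (Q : rooting T) v u : child Q v u -> adj v u.
Proof. by rewrite (adj_par Q) /child => ->; rewrite orbT. Qed.

Lemma adj_child (T : sgraph) (Q : rooting T) u v :
  adj u v = child Q v u || child Q u v.
Proof. by rewrite (adj_par Q). Qed.

Lemma par_child (T : sgraph) (Q : rooting T) v : v != troot Q -> child Q (par Q v) v.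
Proof. by rewrite /child => ->; rewrite eqxx. Qed.

(** Recursion on [h]: iterating [step] more than [h v] times no longer changes
    the value at [v]. *)
Definition ranked_rec (I : Type) (X : Type) (h : I -> nat)
    (step : I -> (I -> X) -> X) (x0 : X) (v : I) : X :=
  iter (h v).+1 (fun f w => step w f) (fun=> x0) v.

Lemma ranked_recE (I X : Type) (h : I -> nat) (step : I -> (I -> X) -> X) x0 v :
  (forall v f g, (forall u, (h u < h v)%N -> f u = g u) -> step v f = step v g) ->
  ranked_rec h step x0 v = step v (ranked_rec h step x0).
Proof.
move=> loc.
have stable n w : (h w < n)%N ->
    iter n (fun f w => step w f) (fun=> x0) w = ranked_rec h step x0 w.
  elim/ltn_ind: n w => -[//|n] IHn w wn; rewrite /ranked_rec /=; apply: loc => u uw.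
  by rewrite (IHn n) ?(leq_trans uw) // (IHn (h w)).
rewrite {1}/ranked_rec /=; apply: loc => u; exact: stable.
Qed.

(** * The matching polynomial by elimination of the deepest vertex *)

(** The matching polynomial with a weight [c v] for each vertex of [S] that the
    matching leaves uncovered. Vertex weights make the sum stable under the
    removal of a leaf. *)
Definition matching_sum (K : fieldType) (G : sgraph) (a : {set G} -> K)
    (c : G -> K) (S : {set G}) : K :=
  \sum_(M in matchings G | cover M \subset S)
    (\prod_(e in M) a e) * \prod_(v in S :\: cover M) c v.

Lemma edge_neq0 (G : sgraph) (e : {set G}) : e \in edges G -> e != set0.
Proof.
rewrite inE => /existsP[x /existsP[y /andP[_ /eqP->]]].
by apply/set0Pn; exists x; rewrite !inE eqxx.
Qed.

Lemma matchings_edge (G : sgraph) (M : {set {set G}}) e :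
  M \in matchings G -> e \in M -> e \in edges G.
Proof. by rewrite inE => /andP[/subsetP sM _] /sM. Qed.

Lemma sub_cover (T : finType) (M : {set {set T}}) e : e \in M -> e \subset cover M.
Proof. exact: bigcup_sup. Qed.

Lemma coverU1 (T : finType) (M : {set {set T}}) e :
  cover (e |: M) = e :|: cover M.
Proof. by rewrite /cover bigcup_setU big_set1. Qed.

Lemma matchings_setU1 (G : sgraph) (M : {set {set G}}) e :
  e \in edges G ->
  (e |: M \in matchings G) && (e \notin M) =
  (M \in matchings G) && [disjoint e & cover M].
Proof.
move=> eG; apply/andP/andP => -[].
  rewrite inE subUset => /andP[/andP[_ sM] tM] eM; split.
    by rewrite inE sM (trivIsetS _ tM) // subsetUr.
  apply/bigcup_disjointP => f fM; apply: (trivIsetP tM).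
  - exact: setU11.
  - by rewrite inE fM orbT.
  - by apply: contraNneq eM => ->.
move=> MG /bigcup_disjointP dM; have := MG; rewrite inE => /andP[sM tM].
have n0 : set0 \notin M.
  by apply/negP => /(matchings_edge MG)/edge_neq0; rewrite eqxx.
have [tU eM] := trivIsetU1 dM tM n0.
by split=> //; rewrite inE subUset sub1set eG sM.
Qed.

(** A vertex without edges inside [S] is left uncovered by every matching of
    [S]. *)
Lemma matching_sum_isolated (K : fieldType) (G : sgraph) (a : {set G} -> K)
    (c : G -> K) (S : {set G}) (l : G) :
  l \in S -> (forall e, e \in edges G -> l \in e -> ~~ (e \subset S)) ->
  matching_sum a c S = c l * matching_sum a c (S :\ l).
Proof.
move=> lS iso; rewrite /matching_sum big_distrr /=.
have subE M : M \in matchings G ->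
    (cover M \subset S) = (cover M \subset S :\ l).
  move=> MG; rewrite subsetD1; case: (boolP (cover M \subset S)) => //= MS.
  apply/esym/negP => /bigcupP[e eM le].
  have /negP := iso e (matchings_edge MG eM) le; apply.
  exact: subset_trans (sub_cover eM) MS.
apply: congr_big => // [M|M /andP[MG MS]].
  by case MG: (M \in matchings G) => //=; apply: subE.
have lM : l \notin cover M by move: MS; rewrite subE // subsetD1 => /andP[].
rewrite (big_setD1 l) /=; last by rewrite inE lM.
by rewrite mulrCA setDDl setUC -setDDl.
Qed.

(** The matchings of [S] either avoid the only edge [lm] at [l], which leaves
    [l] uncovered, or contain it, which removes both of its ends; giving [m] the
    weight [c m + a lm / c l] accounts for the second kind. *)
Lemma matching_sum_leaf (K : fieldType) (G : sgraph) (a : {set G} -> K)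
    (c : G -> K) (S : {set G}) (l m : G) :
  l \in S -> m \in S -> l != m -> [set l; m] \in edges G -> c l != 0 ->
  (forall e, e \in edges G -> l \in e -> e \subset S -> e = [set l; m]) ->
  matching_sum a c S =
  c l * matching_sum a
    (fun v => if v == m then c m + a [set l; m] / c l else c v) (S :\ l).
Proof.
move=> lS mS lm; set lme := [set l; m] => eG cl0 leaf.
have le : l \in lme by rewrite !inE eqxx.
have me : m \in lme by rewrite !inE eqxx orbT.
have eS : lme \subset S by rewrite subUset !sub1set lS.
have disjE (A : {set G}) : [disjoint lme & A] = (l \notin A) && (m \notin A).
  by rewrite disjoints_subset subUset !sub1set !inE.
rewrite /matching_sum big_distrr /= (bigID (fun M : {set {set G}} => lme \in M)) /= addrC.
have avoid (M : {set {set G}}) :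
    [&& M \in matchings G, cover M \subset S & lme \notin M] =
    (M \in matchings G) && (cover M \subset S :\ l).
  case MG: (M \in matchings G) => //=; rewrite subsetD1.
  case MS: (cover M \subset S) => //=; apply: negb_inj.
  rewrite !negbK; apply/idP/bigcupP => [eM|[e eM lie]]; first by exists lme.
  rewrite -(leaf e) //; first exact: matchings_edge eM.
  exact: subset_trans (sub_cover eM) MS.
have through (M : {set {set G}}) :
    [&& (lme |: M \in matchings G) && (cover (lme |: M) \subset S),
        lme \in lme |: M & (lme |: M) :\ lme == M] =
    ((M \in matchings G) && (cover M \subset S :\ l)) && (m \notin cover M).
  rewrite setU11 /= coverU1 subUset eS /= subsetD1.
  have -> : ((lme |: M) :\ lme == M) = (lme \notin M).
    apply/eqP/idP => [<-|]; first by rewrite !inE eqxx.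
    exact: setU1K.
  rewrite -andbA [(cover M \subset S) && _]andbC andbA matchings_setU1 //.
  by rewrite disjE -!andbA; do !bool_congr.
rewrite (eq_bigl (fun M : {set {set G}} =>
  (M \in matchings G) && (cover M \subset S :\ l))); last first.
  by move=> M; rewrite -avoid -andbA.
rewrite [X in _ + X](reindex_onto (fun M : {set {set G}} => lme |: M)
  (fun M : {set {set G}} => M :\ lme)) /=; last first.
  by move=> M /andP[_ eM]; rewrite setD1K.
rewrite [X in _ + X](eq_bigl (fun M : {set {set G}} =>
   ((M \in matchings G) && (cover M \subset S :\ l))
   && (m \notin cover M))); last by move=> M; rewrite -through -!andbA.
rewrite [X in _ + X]big_mkcondr -big_split /=; apply: eq_bigr => M /andP[MG].
rewrite subsetD1 => /andP[MS lM].
have DE : (S :\: cover M) :\ l = (S :\ l) :\: cover M.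
  by rewrite !setDDl setUC.
have lD : l \in S :\: cover M by rewrite inE lM.
rewrite (big_setD1 l lD) /= DE; case: ifP => mM; last first.
  rewrite addr0 mulrCA; congr (_ * (_ * _)); apply: eq_bigr => v.
  by case: (eqVneq v m) => [->|_ _ //]; rewrite inE mM.
have mD : m \in (S :\ l) :\: cover M by rewrite !inE mM eq_sym lm.
have eM : lme \notin M.
  by apply: contra lM => eM; apply: (subsetP (sub_cover eM)).
rewrite (big_setU1 _ eM) /= coverU1.
have -> : S :\: (lme :|: cover M) = ((S :\ l) :\: cover M) :\ m.
  by rewrite /lme !setDDl setUAC -setUA setUCA.
rewrite !(big_setD1 m mD) /= eqxx.
rewrite [X in _ = _ * (_ * (_ * X))](eq_bigr c); last by move=> v; rewrite !inE; case: eqP.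
set P := \prod_(v in _ :\ m) c v; set A := \prod_(e in M) a e.
by field.
Qed.

Definition parent_edge (T : sgraph) (Q : rooting T) (u : T) : {set T} :=
  [set u; par Q u].

Lemma parent_edge_in (T : sgraph) (Q : rooting T) u :
  u != troot Q -> parent_edge Q u \in edges T.
Proof.
move=> ur; rewrite inE; apply/existsP; exists u; apply/existsP; exists (par Q u).
by rewrite eqxx andbT (adj_child Q) par_child // orbT.
Qed.

Lemma edge_parent (T : sgraph) (Q : rooting T) e :
  e \in edges T -> exists2 u, u != troot Q & e = parent_edge Q u.
Proof.
rewrite inE => /existsP[x /existsP[y /andP[]]]; rewrite (adj_child Q).
case/orP=> /andP[r /eqP pE] /eqP->; first by exists x; rewrite // /parent_edge pE.
by exists y; rewrite // /parent_edge pE setUC.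
Qed.

Definition ancestor_closed (T : sgraph) (Q : rooting T) (S : {set T}) : Prop :=
  {in S, forall v, v != troot Q -> par Q v \in S}.

(** Once the vertices outside [S] have been eliminated, deepest first, the
    weight of a vertex [v] of [S] has become [1 + \sum_u a_u / p_u], the sum
    running over the eliminated children of [v]; it is [p v] as soon as [v] is
    deepest in [S]. *)
Lemma matching_sum_elimination (K : fieldType) (T : sgraph) (Q : rooting T)
    (a : {set T} -> K) (p : T -> K) (S : {set T}) :
  (forall v, p v != 0) ->
  (forall v, p v = 1 + \sum_(u | child Q v u) a (parent_edge Q u) / p u) ->
  ancestor_closed Q S ->
  matching_sum a
    (fun v => 1 + \sum_(u | child Q v u && (u \notin S))
                     a (parent_edge Q u) / p u) S =
  \prod_(v in S) p v.
Proof.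
move=> p0 pE; elim: {S}_.+1 {-2}S (ltnSn #|S|) => // n IHn S Sn clS.
have [->|[l0 l0S]] := set_0Vmem S.
  rewrite big_set0 /matching_sum (big_pred1 set0) => [|M].
    by rewrite /cover !big_set0 setD0 big_set0 mulr1.
  apply/andP/eqP => [[MG]|->]; last first.
    rewrite /cover big_set0 subxx inE sub0set; split=> //.
    by apply/trivIsetP => ?; rewrite inE.
  rewrite subset0 => /eqP c0; apply/eqP/negPn/negP => /set0Pn[e eM].
  have /negP := edge_neq0 (matchings_edge MG eM); apply.
  by rewrite -subset0 -c0 sub_cover.
(* The children of a deepest vertex of [S] lie outside [S]. *)
have [l lS lmax] := arg_maxnP (depth Q) l0S; rewrite -/(l \in S) in lS.
have chS u : child Q l u -> u \notin S.
  by move=> /child_depth; apply: contraTN => /lmax; rewrite -leqNgt.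
have pl : 1 + \sum_(u | child Q l u && (u \notin S)) a (parent_edge Q u) / p u = p l.
  rewrite pE; congr (_ + _); apply: eq_bigl => u.
  by case lu: (child Q l u) => //=; apply: chS.
have clD : ancestor_closed Q (S :\ l).
  move=> v; rewrite !inE => /andP[_ vS] vr; rewrite clS // andbT.
  by apply: contraTneq (depth_par vr) => ->; rewrite -leqNgt; apply: lmax.
have Dn : (#|S :\ l| < n)%N by move: Sn; rewrite (cardsD1 l) lS.
have edge_l e : e \in edges T -> l \in e -> e \subset S ->
    l != troot Q /\ e = parent_edge Q l.
  case/(edge_parent Q) => u ur ->; rewrite /parent_edge !inE => /orP[/eqP->//|lu].
  have /chS uS : child Q l u by rewrite /child ur eq_sym.
  by rewrite subUset sub1set (negbTE uS).
rewrite [RHS](big_setD1 l lS) /= -(IHn _ Dn clD).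
case: (eqVneq l (troot Q)) => [lr|lr].
  rewrite (@matching_sum_isolated _ _ _ _ S l) ?pl //; last first.
    move=> e eG le; apply/negP => eS.
    by have [] := edge_l e eG le eS; rewrite lr eqxx.
  congr (_ * _); apply: eq_bigr => M _; congr (_ * _); apply: eq_bigr => v _.
  congr (_ + _); apply: eq_bigl => u; rewrite !inE.
  by case: (eqVneq u l) => [->|//]; rewrite /child lr eqxx.
rewrite (@matching_sum_leaf _ _ _ _ S l (par Q l)) ?pl ?clS //; first last.
- by move=> e eG le eS; have [] := edge_l e eG le eS.
- exact: parent_edge_in.
- by apply: contraTneq (depth_par lr) => <-; rewrite ltnn.
congr (_ * _); apply: eq_bigr => M _; congr (_ * _); apply: eq_bigr => v _.
case: eqP => [->|/eqP vl].
  rewrite -addrA; congr (_ + _).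
  rewrite [RHS](bigD1 l) /=; last by rewrite par_child // !inE eqxx.
  rewrite addrC; congr (_ + _); apply: eq_bigl => u; rewrite !inE.
  by case: (eqVneq u l) => [->|ul]; rewrite ?lS ?andbF ?andbT.
congr (_ + _); apply: eq_bigl => u; rewrite !inE.
by case: (eqVneq u l) => [->|//]; rewrite /child [par Q l == v]eq_sym (negbTE vl) !andbF.
Qed.

Lemma matching_F_prod (R : realType) (T : sgraph) (Q : rooting T)
    (r : {set T} -> R) (t : R) (p : T -> R) :
  (forall v, p v != 0) ->
  (forall v, p v = 1 - t * \sum_(u | child Q v u) r (parent_edge Q u) / p u) ->
  matching_F r t = \prod_v p v.
Proof.
move=> p0 pE; have := @matching_sum_elimination _ _ Q (fun e => - t * r e) p setT p0.
have pE' v : p v = 1 + \sum_(u | child Q v u) - t * r (parent_edge Q u) / p u.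
  rewrite pE mulr_sumr -sumrN; congr (_ + _); apply: eq_bigr => u _.
  by rewrite mulrA !mulNr.
move/(_ pE'); rewrite big_set /= => <-; last by move=> v _ _; rewrite inE.
rewrite /matching_F /matching_sum; apply: eq_big => [M|M _].
  by rewrite subsetT andbT.
rewrite big_split /= prodr_const [X in _ = _ * X]big1 => [|v _]; first by rewrite mulr1 mulrC.
by rewrite big_pred0 ?addr0 // => u; rewrite inE andbF.
Qed.

(** * Survival weights *)

(** The value [0] stands for an undefined weight, when some child has a weight
    that is not positive. The weight at the root is then positive exactly when
    all weights are. *)
Definition survive_step (R : realType) (T : sgraph) (Q : rooting T)
    (r : {set T} -> R) (t : R) (v : T) (f : T -> R) : R :=
  if [forall u, child Q v u ==> (0 < f u)]
  then 1 - t * \sum_(u | child Q v u) r (parent_edge Q u) / f u else 0.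

Definition survive (R : realType) (T : sgraph) (Q : rooting T)
    (r : {set T} -> R) (t : R) : T -> R :=
  ranked_rec (height Q) (survive_step Q r t) 0.

Section Survive.
Variables (R : realType) (T : sgraph) (Q : rooting T) (r : {set T} -> R).
Local Notation survive := (survive Q r).

Lemma surviveE t v : survive t v = survive_step Q r t v (survive t).
Proof.
apply: ranked_recE => {}v f g fg; rewrite /survive_step.
have -> : [forall u, child Q v u ==> (0 < f u)] =
          [forall u, child Q v u ==> (0 < g u)].
  apply: eq_forallb => u; case vu: (child Q v u) => //=.
  by rewrite fg // child_height.
case: ifP => // _; congr (1 - t * _); apply: eq_bigr => u vu.
by rewrite fg // child_height.
Qed.

Lemma survive_children t v : (forall u, child Q v u -> 0 < survive t u) ->
  survive t v = 1 - t * \sum_(u | child Q v u) r (parent_edge Q u) / survive t u.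
Proof.
move=> pos; rewrite surviveE /survive_step ifT //.
by apply/forallP => u; apply/implyP/pos.
Qed.

Lemma survive_child_gt0 t v u : 0 < survive t v -> child Q v u -> 0 < survive t u.
Proof.
rewrite surviveE /survive_step; case: ifP; last by rewrite ltxx.
by move/forallP/(_ u)/implyP.
Qed.

Lemma survive_gt0E t v : 0 < survive t v ->
  survive t v = 1 - t * \sum_(u | child Q v u) r (parent_edge Q u) / survive t u.
Proof. by move=> pos; apply: survive_children => u; apply: survive_child_gt0. Qed.

Lemma survive_gt0 t : 0 < survive t (troot Q) -> forall v, 0 < survive t v.
Proof.
move=> pos v; elim: {v}_.+1 {-2}v (ltnSn (depth Q v)) => // n IHn v vn.
case: (eqVneq v (troot Q)) => [->//|vr].
apply: survive_child_gt0 (par_child vr); apply: IHn.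
exact: leq_trans (depth_par vr) vn.
Qed.

Lemma matching_F_survive t : 0 < survive t (troot Q) ->
  matching_F r t = \prod_v survive t v.
Proof.
move=> /survive_gt0 pos; apply: (@matching_F_prod _ _ Q) => v.
  by rewrite gt_eqF.
exact: survive_gt0E.
Qed.

Lemma survive0 v : survive 0 v = 1.
Proof.
elim: {v}_.+1 {-2}v (ltnSn (height Q v)) => // n IHn v vn.
rewrite survive_children ?mul0r ?subr0 // => u vu.
by rewrite IHn // (leq_trans (child_height vu)).
Qed.

Hypothesis r_ge0 : forall v, v != troot Q -> 0 <= r (parent_edge Q v).

(** Larger [t] and, by induction, smaller weights of the children both lower the
    right-hand side of the defining equation. *)
Lemma survive_decreasing s t v : 0 <= s <= t -> 0 < survive t v ->
  survive t v <= survive s v.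
Proof.
case/andP=> s0 st; elim: {v}_.+1 {-2}v (ltnSn (height Q v)) => // n IHn v vn pos.
have chle u : child Q v u -> survive t u <= survive s u.
  move=> vu; apply: IHn; last exact: survive_child_gt0 pos vu.
  exact: leq_trans (child_height vu) vn.
have chpos u : child Q v u -> 0 < survive t u := survive_child_gt0 pos.
rewrite survive_gt0E // [leRHS]survive_children; last first.
  by move=> u vu; apply: lt_le_trans (chpos u vu) (chle u vu).
have r0 u : child Q v u -> 0 <= r (parent_edge Q u) by case/andP=> /r_ge0.
have sp u : child Q v u -> 0 < survive s u.
  by move=> vu; apply: lt_le_trans (chpos u vu) (chle u vu).
rewrite lerD2l lerN2; apply: ler_pM => //.
  by apply: sumr_ge0 => u vu; rewrite divr_ge0 ?r0 ?ltW ?sp.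
apply: ler_sum => u vu; rewrite ler_wpM2l ?r0 // lef_pV2 ?posrE ?sp ?chpos //.
exact: chle.
Qed.

Lemma survive_le1 t v : 0 <= t -> 0 < survive t v -> survive t v <= 1.
Proof.
move=> t0 pos; rewrite -(survive0 v); apply: survive_decreasing => //.
by rewrite lexx.
Qed.

(** The other factors of the product are at most [1]. *)
Lemma matching_F_le_survive t v : 0 <= t -> 0 < survive t (troot Q) ->
  matching_F r t <= survive t v.
Proof.
move=> t0 rpos; have pos := survive_gt0 rpos.
rewrite matching_F_survive // (bigD1 v) //= -[leRHS]mulr1.
rewrite ler_wpM2l ?(ltW (pos v)) //.
apply: prodr_ile1 => u _; rewrite ltW ?pos //=; exact: survive_le1.
Qed.

Lemma matching_F_gt0 : 0 < survive 1 (troot Q) ->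
  forall t, 0 <= t <= 1 -> 0 < matching_F r t.
Proof.
move=> pos t t01; have post : 0 < survive t (troot Q).
  exact: lt_le_trans pos (survive_decreasing t01 pos).
by rewrite matching_F_survive // prodr_gt0 // => v _; apply: survive_gt0.
Qed.

End Survive.

(** * Surviving vertices form a transversal *)

Definition mass (R : realType) (H : sgraph) (G : blowup R H) (A : {set G}) : R :=
  \sum_(x in A) weight x.

Lemma mass_cluster (R : realType) (H : sgraph) (G : blowup R H) v :
  mass (cluster G v) = 1.
Proof. by rewrite -(weight_sum1 G v); apply: eq_bigl => x; rewrite inE. Qed.

Lemma mass_ge0 (R : realType) (H : sgraph) (G : blowup R H) (A : {set G}) :
  0 <= mass A.
Proof. by apply: sumr_ge0 => x _; apply: weight_ge0. Qed.

Lemma densityC (R : realType) (H : sgraph) (G : blowup R H) u v :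
  density G u v = density G v u.
Proof.
rewrite /density (exchange_big_dep (mem (cluster G v))) /= => [|x y _ /andP[]//].
apply: eq_bigr => y yv; apply: eq_big => [x|x _]; last by rewrite mulrC.
by rewrite yv adj_sym.
Qed.

Lemma nonadjacent_mass (R : realType) (H : sgraph) (G : blowup R H) u v
    (A B : {set G}) :
  A \subset cluster G u -> B \subset cluster G v ->
  {in A & B, forall x y, ~~ adj x y} -> mass A * mass B <= 1 - density G u v.
Proof.
move=> /subsetP Au /subsetP Bv nadj; rewrite lerBrDr.
have -> : 1 = mass (cluster G u) * mass (cluster G v) :> R.
  by rewrite !mass_cluster mulr1.
rewrite /mass /density !big_distrl /= [X in _ + X](bigID (mem A)) /= addrA.
have w0 (x : G) := weight_ge0 x.
rewrite [leRHS](bigID (mem A)) /= lerD //; last first.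
  apply: ler_sum => x _; rewrite big_distrr [leRHS](bigID (adj x)) /=.
  by rewrite lerDl sumr_ge0 // => y _; rewrite mulr_ge0.
have AE (F : G -> R) : \sum_(x in cluster G u | x \in A) F x = \sum_(x in A) F x.
  by apply: eq_bigl => x; rewrite andbC; case xA: (x \in A); rewrite //= Au.
rewrite !AE -big_split /=; apply: ler_sum => x xA.
rewrite big_distrr [leRHS]big_distrr [leRHS](bigID (adj x)) /= addrC lerD2l.
rewrite [leRHS](bigID (mem B)) /= -[leLHS]addr0 lerD //; last first.
  by rewrite sumr_ge0 // => y _; rewrite mulr_ge0.
rewrite (eq_bigl (fun y => ((y \in cluster G v) && ~~ adj x y) && (y \in B))) //.
by move=> y; case yB: (y \in B); rewrite ?andbF // Bv // nadj.
Qed.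

(** The vertices of the cluster of [v] from which the part of the transversal
    below [v] can be completed. *)
Definition extendable (R : realType) (T : sgraph) (Q : rooting T)
    (G : blowup R T) : T -> {set G} :=
  ranked_rec (height Q)
    (fun v (f : T -> {set G}) => [set x in cluster G v |
       [forall u, child Q v u ==> [exists y, (y \in f u) && adj x y]]]) set0.

Lemma extendableE (R : realType) (T : sgraph) (Q : rooting T) (G : blowup R T) v :
  extendable Q G v = [set x in cluster G v | [forall u, child Q v u ==>
    [exists y, (y \in extendable Q G u) && adj x y]]].
Proof.
rewrite {1}/extendable; apply: ranked_recE => {}v f g fg.
apply/setP => x; rewrite !inE; congr (_ && _); apply: eq_forallb => u.
by case vu: (child Q v u) => //=; rewrite fg // child_height.
Qed.

Lemma extendable_cluster (R : realType) (T : sgraph) (Q : rooting T)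
    (G : blowup R T) v : extendable Q G v \subset cluster G v.
Proof. by rewrite extendableE; apply/subsetP => x; rewrite inE => /andP[]. Qed.

(** A vertex of the cluster of [v] is lost through a child [u] when all its
    neighbours in the cluster of [u] are lost; by [nonadjacent_mass] at most
    [r_u / survive u] is lost that way. *)
Lemma extendable_mass (R : realType) (T : sgraph) (Q : rooting T)
    (r : {set T} -> R) (G : blowup R T) :
  (forall u v, child Q v u -> 1 - r (parent_edge Q u) <= density G v u) ->
  0 < survive Q r 1 (troot Q) ->
  forall v, survive Q r 1 v <= mass (extendable Q G v).
Proof.
move=> dens /survive_gt0 pos v.
elim: {v}_.+1 {-2}v (ltnSn (height Q v)) => // n IHn v vn.
rewrite survive_gt0E // mul1r lerBlDr -[leLHS](mass_cluster G v).
pose lost u : {set G} := [set x in cluster G v |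
  ~~ [exists y, (y \in extendable Q G u) && adj x y]].
have lostB u : child Q v u -> mass (lost u) <= r (parent_edge Q u) / survive Q r 1 u.
  move=> vu; rewrite ler_pdivlMr //.
  have := dens u v vu; rewrite lerBlDl -lerBlDr; apply: le_trans.
  have ext_u : survive Q r 1 u <= mass (extendable Q G u).
    by apply: IHn; apply: leq_trans (child_height vu) vn.
  apply: le_trans (ler_wpM2l (mass_ge0 _) ext_u) _.
  apply: nonadjacent_mass; last 1 first.
  - move=> x y; rewrite inE => /andP[_ /existsPn /(_ y)] xy yu.
    by move: xy; rewrite yu.
  - by apply/subsetP => x; rewrite inE => /andP[].
  - exact: extendable_cluster.
apply: (@le_trans _ _ (mass (extendable Q G v) + \sum_(u | child Q v u) mass (lost u))).
  rewrite {1}/mass (bigID (mem (extendable Q G v))) /= lerD //.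
    rewrite le_eqVlt; apply/orP; left; apply/eqP; apply: eq_bigl => x.
    by rewrite andbC; case: (boolP (x \in extendable Q G v)) => //= /(subsetP (extendable_cluster _ _ _)).
  rewrite /mass (exchange_big_dep xpredT) //= [leRHS](bigID (fun x =>
    (x \in cluster G v) && (x \notin extendable Q G v))) /=.
  rewrite -[leLHS]addr0 lerD //; last first.
    by apply: sumr_ge0 => x _; apply: sumr_ge0 => u _; apply: weight_ge0.
  apply: ler_sum => x /andP[xv]; rewrite extendableE inE xv /= => /forallPn[u].
  rewrite negb_imply => /andP[vu nx].
  rewrite (bigD1 u) /=; last by rewrite vu inE xv.
  by rewrite lerDl sumr_ge0 // => w _; apply: weight_ge0.
by rewrite lerD2l; apply: ler_sum => u; apply: lostB.
Qed.

(** Extendable vertices at the root have positive mass; from one of them the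
    transversal is chosen downwards inside the extendable sets. *)
Lemma transversal_of_survive (R : realType) (T : sgraph) (Q : rooting T)
    (r : {set T} -> R) (G : blowup R T) :
  (forall u v, child Q v u -> 1 - r (parent_edge Q u) <= density G v u) ->
  0 < survive Q r 1 (troot Q) -> has_transversal G.
Proof.
move=> dens pos; have [x0 x0B] : exists x, x \in extendable Q G (troot Q).
  apply/set0Pn; apply: contraTneq (extendable_mass dens pos (troot Q)) => ->.
  by rewrite /mass big_set0 -ltNge.
pose next u y := odflt y [pick z in extendable Q G u | adj y z].
have nextP u v y : child Q v u -> y \in extendable Q G v ->
    (next u y \in extendable Q G u) && adj y (next u y).
  move=> vu; rewrite extendableE inE => /andP[_ /forallP /(_ u)].
  rewrite vu /= => /existsP[z zP]; rewrite /next.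
  by case: pickP => [//|/(_ z)]; rewrite zP.
pose phi := ranked_rec (depth Q)
  (fun v f => if v == troot Q then x0 else next v (f (par Q v))) x0.
have phiE v : phi v = if v == troot Q then x0 else next v (phi (par Q v)).
  apply: ranked_recE => {}v f g fg; case: eqP => // /eqP vr.
  by rewrite fg // depth_par.
have phiB v : phi v \in extendable Q G v.
  elim: {v}_.+1 {-2}v (ltnSn (depth Q v)) => // n IHn v vn; rewrite phiE.
  case: eqVneq => [->//|vr].
  have /IHn pv : (depth Q (par Q v) < n)%N by apply: leq_trans (depth_par vr) vn.
  by have /andP[] := nextP v _ _ (par_child vr) pv.
have phi_par v u : child Q v u -> adj (phi v) (phi u).
  move=> vu; have /andP[ur /eqP pu] := vu.
  have /andP[_] := nextP u v _ vu (phiB v).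
  by rewrite [phi u]phiE (negbTE ur) pu.
exists phi; split=> [v|u v].
  exact: subsetP (extendable_cluster Q G v) _ (phiB v).
by rewrite (adj_child Q) => /orP[/phi_par|/phi_par //]; rewrite adj_sym.
Qed.

(** * The extremal blow-up *)

Definition incident (T : sgraph) (Q : rooting T) : rel T :=
  fun v e => (e != troot Q) && ((e == v) || (par Q e == v)).

(** A pair [(v, e)] is the vertex of the cluster of [v] that chooses the edge
    [e]. To avoid a subtype, pairs that are not incident are kept as isolated
    vertices; they will have weight [0]. *)
Definition choice_adj (T : sgraph) (Q : rooting T) : rel (T * T) := fun x y =>
  [&& adj x.1 y.1, incident Q x.1 x.2, incident Q y.1 y.2 & x.2 != y.2].

Lemma choice_adj_sym (T : sgraph) (Q : rooting T) : symmetric (choice_adj Q).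
Proof.
move=> x y; rewrite /choice_adj adj_sym [y.2 == _]eq_sym.
by congr (_ && _); rewrite andbCA.
Qed.

Lemma choice_adj_irrefl (T : sgraph) (Q : rooting T) : irreflexive (choice_adj Q).
Proof. by move=> x; rewrite /choice_adj adj_irrefl. Qed.

Definition choice_graph (T : sgraph) (Q : rooting T) : sgraph :=
  SGraph (@choice_adj_sym T Q) (@choice_adj_irrefl T Q).

Lemma choice_proj_surj (T : sgraph) v : exists x : T * T, x.1 = v.
Proof. by exists (v, v). Qed.

Lemma choice_proj_adj (T : sgraph) (Q : rooting T) (x y : choice_graph Q) :
  adj x y -> @adj T x.1 y.1.
Proof. by case/and4P. Qed.

Lemma choice_weight_sum1 (R : realType) (T : sgraph) (w : T -> T -> R) :
  (forall v, \sum_e w v e = 1) ->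
  forall v, \sum_(x : T * T | x.1 == v) w x.1 x.2 = 1.
Proof.
move=> w1 v; rewrite -[RHS](w1 v).
rewrite (reindex_onto (fun e => (v, e)) snd) /=; last by move=> [a b] /= /eqP->.
by apply: eq_bigl => e; rewrite !eqxx.
Qed.

Definition choice_blowup (R : realType) (T : sgraph) (Q : rooting T)
    (w : T -> T -> R) (w0 : forall v e, 0 <= w v e)
    (w1 : forall v, \sum_e w v e = 1) : blowup R T :=
  @Blowup R T (choice_graph Q) fst (fun x => w x.1 x.2)
    (@choice_proj_surj T) (@choice_proj_adj T Q)
    (fun x => w0 x.1 x.2) (choice_weight_sum1 w1).

(** A transversal would assign to each of the [#|T|] vertices one of the
    [#|T| - 1] edges at it, and no edge can be assigned to both of its ends. *)
Lemma choice_blowup_no_transversal (R : realType) (T : sgraph) (Q : rooting T)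
    (w : T -> T -> R) w0 w1 :
  (exists u, child Q (troot Q) u) ->
  ~ has_transversal (choice_blowup Q (w := w) w0 w1).
Proof.
move=> [u0 cu0] [phi [phiC phiA]].
have phi1 v : (phi v).1 = v by have := phiC v; rewrite inE => /eqP.
have inc v : incident Q v (phi v).2.
  (* A vertex of the transversal has a neighbour in it, so it is not isolated
     and its pair is incident. *)
  have [y vy] : exists y, adj v y.
    case: (eqVneq v (troot Q)) => [->|vr]; first by exists u0; apply: child_adj cu0.
    by exists (par Q v); rewrite adj_sym (child_adj (par_child vr)).
  by have /and4P[_] := phiA v y vy; rewrite phi1.
have inj : injective (fun v => (phi v).2).
  move=> u v uv; have := inc u; have := inc v; rewrite -uv /incident.
  have noedge : ~~ adj u v.
    by apply/negP => /phiA /and4P[_ _ _]; rewrite uv eqxx.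
  set e := (phi u).2 => /andP[er ev] /andP[_ eu].
  case/orP: eu ev => /eqP eu /orP[] /eqP ev; rewrite -?eu -?ev //;
    move: noedge; rewrite -eu -ev.
    by rewrite adj_sym (child_adj (par_child er)).
  by rewrite (child_adj (par_child er)).
have [g _ gK] := injF_bij inj.
by have := inc (g (troot Q)); rewrite gK /incident eqxx.
Qed.

(** Neighbours share no edge but the one that joins them. *)
Lemma common_incident (T : sgraph) (Q : rooting T) v u e :
  child Q v u -> incident Q v e -> incident Q u e -> e = u.
Proof.
move=> vu /andP[er ev] /andP[_ /orP[/eqP//|/eqP eu]].
have: (depth Q u < depth Q e)%N by rewrite -eu; apply: depth_par.
case/orP: ev => /eqP ev.
  by rewrite ev ltnNge (ltnW (child_depth vu)).
by have := child_depth vu; rewrite -ev -eu ltnn.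
Qed.

(** Between the clusters of [v] and of its child [u] the only missing pair of
    positive weight is the one where both choose the edge [u]. *)
Lemma choice_blowup_density (R : realType) (T : sgraph) (Q : rooting T)
    (w : T -> T -> R) w0 w1 u v :
  (forall v e, ~~ incident Q v e -> w v e = 0) -> child Q v u ->
  1 - w v u * w u u <= density (choice_blowup Q (w := w) w0 w1) v u.
Proof.
move=> supp vu; set G := choice_blowup _ _ _.
have clE (F : G -> R) z : \sum_(x in cluster G z) F x = \sum_e F (z, e).
  rewrite (reindex_onto (fun e => (z, e)) snd) /=; last first.
    by move=> [a b]; rewrite inE => /eqP /= ->.
  by apply: eq_bigl => e; rewrite inE /= !eqxx.
rewrite lerBlDr /density clE.
have inner e : \sum_(y in cluster G u | choice_adj Q (v, e) y) w v e * w y.1 y.2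
    = \sum_(e' | choice_adj Q (v, e) (u, e')) w v e * w u e'.
  by rewrite big_mkcondr clE -big_mkcond.
have zero e e' : ~~ choice_adj Q (v, e) (u, e') -> (e != u) || (e' != u) ->
    w v e * w u e' = 0.
  rewrite /choice_adj /= (child_adj vu) /= => nadj.
  case ve: (incident Q v e); last by rewrite supp ?ve ?mul0r.
  case ue: (incident Q u e'); last by rewrite [w u e']supp ?ue ?mulr0.
  move: nadj; rewrite ve ue /= negbK => /eqP ee'; subst e'.
  by rewrite (common_incident vu ve ue) eqxx.
(* Written as a sum, the exceptional term can be compared row by row. *)
have -> : w v u * w u u = \sum_e (if e == u then w v u * w u u else 0).
  by rewrite -big_mkcond big_pred1_eq.
have -> : 1 = (\sum_e w v e) * (\sum_e w u e) by rewrite !w1 mulr1.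
rewrite big_distrl -big_split /=; apply: ler_sum => e _; rewrite inner big_distrr /=.
rewrite [leLHS](bigID (fun e' => choice_adj Q (v, e) (u, e'))) /= lerD2l.
case: eqP => [->|/eqP eu]; last first.
  by rewrite big1 // => e' /zero; apply; rewrite eu.
rewrite (bigD1 u) /=; last by rewrite /choice_adj /= eqxx !andbF.
rewrite big1 ?addr0 // => e' /andP[/zero z e'u]; apply: z.
by rewrite e'u orbT.
Qed.

(** A vertex gives its survival weight, if positive, to its parent edge, and to
    the edge of a child [u] the weight [r_u / s u], for which the product of the
    two weights of this edge is [r_u]; if these numbers have a sum above [1] they
    are scaled down. A vertex that has a child [u] with [s u <= 0] gives
    everything to the edge of one such child, which does not use that edge. *)
Definition extremal_weight (R : realType) (T : sgraph) (Q : rooting T)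
    (r : {set T} -> R) (v e : T) : R :=
  let s := survive Q r 1 in
  if e == v then Num.max 0 (s v) else if ~~ child Q v e then 0 else
  if [pick u | child Q v u && (s u <= 0)] is Some u then (e == u)%:R
  else r (parent_edge Q e) / s e
       / Num.max 1 (\sum_(u | child Q v u) r (parent_edge Q u) / s u).

Section Extremal.
Variables (R : realType) (T : sgraph) (Q : rooting T) (r : {set T} -> R).
Hypothesis r_ge0 : forall v, v != troot Q -> 0 <= r (parent_edge Q v).
Local Notation s := (survive Q r 1).
Local Notation w := (extremal_weight Q r).

Lemma child_neq v u : child Q v u -> u == v = false.
Proof. by move=> /child_depth; apply: contraTF => /eqP->; rewrite ltnn. Qed.

Lemma child_term_ge0 v u : (forall u, child Q v u -> 0 < s u) -> child Q v u ->
  0 <= r (parent_edge Q u) / s u.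
Proof. by move=> pos vu; rewrite divr_ge0 ?(ltW (pos u vu)) // r_ge0; case/andP: vu. Qed.

Lemma max1_gt0 (x : R) : 0 < Num.max 1 x.
Proof. by rewrite lt_max ltr01. Qed.

Lemma extremal_weight_ge0 v e : 0 <= w v e.
Proof.
rewrite /extremal_weight; case: ifP => _; first by rewrite le_max lexx.
case: ifP => // /negbFE ve; case: pickP => [u _|pos]; first exact: ler0n.
rewrite divr_ge0 ?(ltW (max1_gt0 _)) // (@child_term_ge0 v) // => u vu.
by have := pos u; rewrite vu /= => /negbT; rewrite -ltNge.
Qed.

Lemma extremal_weight_sum1 v : \sum_e w v e = 1.
Proof.
rewrite (bigD1 v) //= {1}/extremal_weight eqxx (bigID (child Q v)) /=.
rewrite [X in _ + (_ + X)]big1 => [|e /andP[/negbTE ev vNe]]; last first.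
  by rewrite /extremal_weight ev vNe.
rewrite addr0 (eq_bigl (child Q v)) => [|e]; last first.
  by case ve: (child Q v e); rewrite ?andbF // (child_neq ve).
have wE e : child Q v e -> w v e =
    if [pick u | child Q v u && (s u <= 0)] is Some u then (e == u)%:R
    else r (parent_edge Q e) / s e
       / Num.max 1 (\sum_(u | child Q v u) r (parent_edge Q u) / s u).
  by move=> ve; rewrite /extremal_weight (child_neq ve) ve.
rewrite (eq_bigr _ wE); case: pickP => [u /andP[vu su]|pos].
  rewrite (bigD1 u) //= eqxx big1 ?addr0 => [|e /andP[_ /negbTE->] //].
  case: (ltP 0 (s v)) => [/survive_child_gt0/(_ vu)|].
    by rewrite ltNge su.
  by rewrite add0r.
have pos' u : child Q v u -> 0 < s u.
  by move=> vu; have := pos u; rewrite vu /= => /negbT; rewrite -ltNge.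
rewrite -mulr_suml (survive_children pos') mul1r.
set c := \sum_(u | _) _.
have [c1|/ltW c1] := leP 1 c.
  rewrite (@max_l _ _ 0) ?subr_le0 // add0r divff //.
  by rewrite gt_eqF // (lt_le_trans ltr01).
by rewrite (@max_r _ _ 0) ?subr_ge0 // divr1 subrK.
Qed.

Lemma extremal_weight_supp v e : s (troot Q) <= 0 -> ~~ incident Q v e -> w v e = 0.
Proof.
move=> s0; rewrite /extremal_weight /incident; case: (e =P v) => [->|_ /=].
  by rewrite /= andbT negbK => /eqP ->; case: ltP s0 => //; rewrite ltNge => /negbTE->.
by rewrite /child => ->.
Qed.

Lemma extremal_weight_tight v u : child Q v u -> w v u * w u u <= r (parent_edge Q u).
Proof.
move=> vu; have r0 : 0 <= r (parent_edge Q u) by rewrite r_ge0 //; case/andP: vu.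
rewrite [w u u]/extremal_weight eqxx; case: (leP (s u) 0) => su; first by rewrite mulr0.
rewrite /extremal_weight (child_neq vu) vu /=; case: pickP => [u' /andP[_ su']|_].
  by case: eqP su' => [<-|_]; rewrite ?mul0r // leNgt su.
rewrite mulrAC divfK ?gt_eqF // ler_pdivrMr ?max1_gt0 //.
by rewrite ler_peMr // le_max lexx.
Qed.

Lemma survive_of_ensures (gamma : {set T} -> R) :
  (forall e, e \in edges T -> gamma e = 1 - r e) ->
  ensures_transversal gamma -> 0 < s (troot Q).
Proof.
move=> gr ens; rewrite ltNge; apply/negP => s0.
(* A root without children would have survival weight [1]. *)
have [u0 cu0] : exists u, child Q (troot Q) u.
  apply/existsP; apply: contraTT s0 => /existsPn noch.
  rewrite survive_children => [|u /(negP (noch u)) //].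
  by rewrite big_pred0 => [|u]; [rewrite mulr0 subr0 -ltNge ltr01|apply: negbTE].
pose G := choice_blowup Q extremal_weight_ge0 extremal_weight_sum1.
have dens v u : child Q v u -> gamma (parent_edge Q u) <= density G v u.
  move=> vu; have ur : u != troot Q by case/andP: vu.
  rewrite gr ?parent_edge_in //; apply: le_trans (choice_blowup_density _ _ _ vu).
    by rewrite lerD2l lerN2 extremal_weight_tight.
  by move=> z e; apply: extremal_weight_supp.
apply: (@choice_blowup_no_transversal R T Q w extremal_weight_ge0 extremal_weight_sum1).
  by exists u0.
apply: ens => u v; rewrite (adj_child Q) => /orP[|] vu.
  have := dens v u vu; rewrite densityC; case/andP: (vu) => _ /eqP pu.
  by rewrite /parent_edge pu.
have := dens u v vu; case/andP: (vu) => _ /eqP pu.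
by rewrite /parent_edge pu setUC.
Qed.

End Extremal.

From mathcomp Require Import boolp classical_sets filter topology normedtype realfun.
Import numFieldNormedType.Exports.
Local Open Scope classical_set_scope.
Local Open Scope ring_scope.

(** * The threshold *)

Section Threshold.
Variables (R : realType) (T : sgraph) (Q : rooting T) (r : {set T} -> R).
Local Notation survive := (survive Q r).

(** Near [s] the children keep positive weights, so the defining equation holds
    there and passes to the limit. *)
Lemma survive_cvg (s : R) v : (forall u, child Q v u -> 0 < survive s u) ->
  survive t v @[t --> s] --> survive s v.
Proof.
elim: {v}_.+1 {-2}v (ltnSn (height Q v)) => // n IHn v vn pos.
have chcvg u : child Q v u -> survive t u @[t --> s] --> survive s u.
  move=> vu; apply: IHn; first exact: leq_trans (child_height vu) vn.
  by move=> w; apply: survive_child_gt0 (pos u vu).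
have near_pos : \forall t \near s, forall u, child Q v u -> 0 < survive t u.
  have pos_u u : \forall t \near s, child Q v u -> 0 < survive t u.
    case vu: (child Q v u); last by near=> t.
    by apply: filterS (cvgr_gt _ (chcvg u vu) _ (pos u vu)) => t tu _; exact: tu.
  exact: (filter_forall _ pos_u).
rewrite [X in _ --> X]survive_children //.
have near_eq : \forall t \near s,
    1 - t * (\sum_(u | child Q v u) r (parent_edge Q u) / survive t u) = survive t v.
  by apply: filterS near_pos => t post; apply/esym/survive_children.
apply: cvg_trans (near_eq_cvg near_eq) _.
apply: cvgB; first exact: cvg_cst.
apply: cvgM; first exact: cvg_id.
apply: cvg_big => [|u vu]; first exact: add_continuous.
apply: cvgM; first exact: cvg_cst.
apply: cvgV; last exact: chcvg.
by rewrite gt_eqF // pos.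
Unshelve. all: by end_near.
Qed.

Lemma matching_F_cvg (s : R) : matching_F r t @[t --> s] --> matching_F r s.
Proof.
have pow_cont n : continuous (fun t : R => (- t) ^+ n).
  move=> t; apply: (@continuous_comp _ _ _ -%R (fun x : R => x ^+ n)).
    exact: opp_continuous.
  exact: exprn_continuous.
apply: cvg_big => [|M _]; first exact: add_continuous.
apply: cvgM; first exact: cvg_cst.
exact: pow_cont.
Qed.

Hypothesis r_ge0 : forall v, v != troot Q -> 0 <= r (parent_edge Q v).

(** Below [s] every survival weight is at least [matching_F r], whose limit at
    [s] is positive; so no weight can reach [0] at [s]. *)
Lemma survive_gt0_closed (s : R) : 0 <= s -> 0 < matching_F r s ->
  (forall t : R, 0 <= t -> t < s -> 0 < survive t (troot Q)) ->
  forall v, 0 < survive s v.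
Proof.
move=> s0 Fs below v; move: s0; rewrite le_eqVlt => /orP[/eqP <-|s0].
  by rewrite survive0.
elim: {v}_.+1 {-2}v (ltnSn (height Q v)) => // n IHn v vn.
apply: lt_le_trans Fs _.
have chpos u : child Q v u -> 0 < survive s u.
  by move=> vu; apply: IHn; apply: leq_trans (child_height vu) vn.
apply: (ler_cvg_to (cvg_at_left_filter (@matching_F_cvg s))
                   (cvg_at_left_filter (survive_cvg chpos))).
near=> t; have t0 : 0 <= t by near: t; exact: nbhs_left_ge.
apply: matching_F_le_survive => //; exact: below.
Unshelve. all: by end_near.
Qed.

(** The supremum of the [t] with positive weights has positive weights, by
    [survive_gt0_closed]; were it below [1], continuity would give larger such
    [t]. *)
Lemma survive_of_matching_F : (forall t : R, 0 <= t <= 1 -> 0 < matching_F r t) ->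
  0 < survive 1 (troot Q).
Proof.
move=> Fpos; pose A := [set t : R | 0 <= t <= 1 /\ 0 < survive t (troot Q)].
have A0 : A 0 by split; rewrite ?lexx ?ler01 ?survive0.
have A1 : ubound A 1 by move=> t [/andP[_ ->]].
have hA : has_ubound A by exists 1.
pose s := sup A.
have s0 : 0 <= s by exact: ub_le_sup.
have s1 : s <= 1 by apply: ge_sup => //; exists 0.
have below t : 0 <= t -> t < s -> 0 < survive t (troot Q).
  move=> t0 /(sup_gt (ex_intro _ 0 A0))[a [/andP[a0 a1] apos] ta].
  by apply: lt_le_trans apos (survive_decreasing r_ge0 _ apos); rewrite t0 ltW.
have spos := survive_gt0_closed s0 (Fpos s (introT andP (conj s0 s1))) below.
move: s1; rewrite le_eqVlt => /orP[/eqP <- //|s1].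
have [t [st t1 tpos]] : exists t, [/\ s < t, t < 1 & 0 < survive t (troot Q)].
  apply: (@filter_ex _ s^'+); near=> t; split; near: t.
  - exact: nbhs_right_gt.
  - exact: nbhs_right_lt.
  - apply: (cvgr_gt _ _ _ (spos (troot Q))).
    exact: cvg_at_right_filter (survive_cvg (fun u _ => spos u)).
have : t <= s by apply: ub_le_sup => //; split; rewrite ?(ltW t1) ?(le_trans s0) ?ltW.
by rewrite leNgt st.
Unshelve. all: by end_near.
Qed.

End Threshold.

Theorem theorem3p8 (R : realType) (T : sgraph) (gamma r : {set T} -> R)
    (T_tree : is_tree T)
    (gamma_r : forall e, e \in edges T -> gamma e = 1 - r e)
    (gamma01 : forall e, e \in edges T -> 0 <= gamma e <= 1) :
  ensures_transversal gamma <->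
  (forall t : R, 0 <= t <= 1 -> 0 < matching_F r t).
Proof.
have [Q] := tree_rooting T_tree.
have r_ge0 v : v != troot Q -> 0 <= r (parent_edge Q v).
  move=> /parent_edge_in eT; have /andP[_] := gamma01 _ eT.
  by rewrite gamma_r // gerBl.
split=> [ens|Fpos G dens].
  exact: matching_F_gt0 r_ge0 (survive_of_ensures r_ge0 gamma_r ens).
apply: transversal_of_survive (survive_of_matching_F r_ge0 Fpos) => u v vu.
have /andP[ur /eqP pu] := vu; rewrite -gamma_r ?parent_edge_in //.
by rewrite /parent_edge pu finset.setUC dens // (child_adj vu).
Qed.
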